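(* For any $i\in\mathbb{Z}_{\geq 0}$ and any $x\in\mathbb{R}^{n_x}$, $$\underline{V}_i(x)\leq V_i(x)\leq\overline{V}_i(x),$$ where $V_i$ is defined by value iteration and is initialized with $\underline{V}_0(x)=V_0(x)=\overline{V}_0(x)$. In addition, when $\mu=0$ or $\nu=1$, $\underline{V}_i(x)=V_i(x)=\overline{V}_i(x)$ for any $i\in\mathbb{Z}_{\geq 0}$ and any $x\in\mathbb{R}^{n_x}$.
   Context: Notation. Let $n_x,n_u$ be positive integers. For $r=(r_1,\dots,r_n)$ with all $r_i>0$, the dilation map is $\lambda^r(\varepsilon)x:=(\varepsilon^{r_1}x_1,\dots,\varepsilon^{r_n}x_n)$ for $\varepsilon>0$, $x\in\mathbb{R}^n$; for a real exponent $s$, $\lambda^r(\varepsilon)^{s}:=\lambda^r(\varepsilon^{s})$. The homogeneous ray through $x$ is $\mathcal{R}_r(x):=\{\lambda^r(\varepsilon)x:\varepsilon>0\}$. System and cost. $f:\mathbb{R}^{n_x}\times\mathbb{R}^{n_u}\to\mathbb{R}^{n_x}$ defines the discrete-time system $x^+=f(x,u)$, and $\ell:\mathbb{R}^{n_x}\times\mathbb{R}^{n_u}\to[0,\infty]$ is the stage cost; the cost considered has infinite horizon and the terminal cost is zero. Standing assumptions. (1) There are $\nu>0$, $r\in\mathbb{R}_{>0}^{n_x}$, $q\in\mathbb{R}_{>0}^{n_u}$ with $f(\lambda^r(\varepsilon)x,\lambda^q(\varepsilon)u)=\lambda^r(\varepsilon)^{\nu}f(x,u)$ for all $(x,u)\in\mathbb{R}^{n_x}\times\mathbb{R}^{n_u}$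 and $\varepsilon>0$. (2) There is $\mu\in\mathbb{R}$ with $\ell(\lambda^r(\varepsilon)x,\lambda^q(\varepsilon)u)=\varepsilon^{\mu}\ell(x,u)$ for all $(x,u)\in\mathbb{R}^{n_x}\times\mathbb{R}^{n_u}$ and $\varepsilon>0$. (3) For every horizon $d\in\mathbb{Z}_{>0}\cup\{\infty\}$, $\gamma_1>0$, $\gamma_2\in\mathbb{R}$ and initial state $x_0\in\mathbb{R}^{n_x}$, the minimum over input sequences $(u_0,\dots,u_{d-1})$ in $\mathbb{R}^{n_u}$ of $\sum_{k=0}^{d-1}\gamma_1^{\gamma_2^k}\ell(x_k,u_k)$, where $x_{k+1}=f(x_k,u_k)$, is attained and finite. Value iteration. $V_0:\mathbb{R}^{n_x}\to[0,\infty)$ satisfies $V_0(\lambda^r(\varepsilon)x)=\varepsilon^{\mu}V_0(x)$ for all $x\in\mathbb{R}^{n_x}$ and $\varepsilon>0$. For $i\in\mathbb{Z}_{\geq 0}$ and all $x\in\mathbb{R}^{n_x}$, $V_{i+1}(x)=\min_{u\in\mathbb{R}^{n_u}}[\ell(x,u)+V_i(f(x,u))]$. Approximate scheme. $\mathcal{D}\subset\mathbb{R}^{n_x}$ is a compact set with $\bigcup_{x\in\mathcal{D}}\mathcal{R}_r(x)=\mathbb{R}^{n_x}\setminus\{0\}$. Set $\underline{V}_0=\overline{V}_0=V_0$. The functions $\underline{V}_i,\overline{V}_i$ on $\mathbb{R}^{n_x}$ satisfy $\underline{V}_i(0)=\overline{V}_i(0)=0$ for all $i\in\mathbb{Z}_{\geq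 0}$ (so in particular $V_0(0)=0$) and, for every $i\in\mathbb{Z}_{\geq 0}$, $x\in\mathcal{D}$ and $\varepsilon>0$, $$\underline{V}_{i+1}(x)=\min_u[\ell(x,u)+\underline{V}_i(f(x,u))],\qquad \underline{V}_{i+1}(\lambda^r(\varepsilon)x)=\min\{\varepsilon^{\mu},\varepsilon^{\mu\nu^{i+1}}\}\,\underline{V}_{i+1}(x),$$ $$\overline{V}_{i+1}(x)=\min_u[\ell(x,u)+\overline{V}_i(f(x,u))],\qquad \overline{V}_{i+1}(\lambda^r(\varepsilon)x)=\max\{\varepsilon^{\mu},\varepsilon^{\mu\nu^{i+1}}\}\,\overline{V}_{i+1}(x).$$ All the minima above are assumed to exist.
   Formalization: For μ=0 it is additionally assumed that some input u has f(0,u)=0 and ℓ(0,u)=0 (e.g. ℓ(0,0)=0); otherwise V_1(0)>0 can occur although the approximations vanish at 0 (f=x+u, ℓ=1 at x=0 and 0 elsewhere, V_0=0). *)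

(* Defs.v *)
From HB Require Import structures.
From mathcomp Require Import all_boot all_order all_algebra.
From mathcomp Require Import all_classical all_reals all_analysis.
Set Implicit Arguments.
Unset Strict Implicit.
Unset Printing Implicit Defensive.
Import Order.TTheory GRing.Theory Num.Theory.
Import numFieldNormedType.Exports.
Local Open Scope classical_set_scope.
Local Open Scope ring_scope.

Section Defs.
Context {R : realType}.

Definition dilation n (r : 'rV[R]_n) (e : R) (x : 'rV[R]_n) : 'rV[R]_n :=
  \row_j (e `^ r 0 j * x 0 j).

Definition homogeneous_ray n (r : 'rV[R]_n) (x : 'rV[R]_n) : set 'rV[R]_n :=
  [set dilation r e x | e in [set e : R | 0 < e]].

Definition is_min (A : set \bar R) (m : \bar R) : Prop := A m /\ lbound A m.

Section System.
Context {nX nU : nat}.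
Implicit Types (f : 'rV[R]_nX -> 'rV[R]_nU -> 'rV[R]_nX)
  (l : 'rV[R]_nX -> 'rV[R]_nU -> \bar R).

Fixpoint trajectory f (x0 : 'rV[R]_nX) (u : nat -> 'rV[R]_nU) (k : nat)
    : 'rV[R]_nX :=
  if k is k'.+1 then f (trajectory f x0 u k') (u k') else x0.

(* The horizon [None] is infinite.  For [Some d], only the inputs
   [u 0], ..., [u d.-1] matter, so minimizing over infinite input sequences is
   minimizing over sequences of length [d]. *)
Definition weighted_cost f l (d : option nat) (gamma1 gamma2 : R)
    (x0 : 'rV[R]_nX) (u : nat -> 'rV[R]_nU) : \bar R :=
  let term k :=
    ((gamma1 `^ (gamma2 ^+ k))%:E * l (trajectory f x0 u k) (u k))%E in
  if d is Some d' then (\sum_(0 <= k < d') term k)%E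
  else (\sum_(0 <= k <oo) term k)%E.

Definition optimal_cost_attained f l : Prop :=
  forall (d : option nat) (gamma1 gamma2 : R) (x0 : 'rV[R]_nX),
    d != Some 0%N -> 0 < gamma1 ->
    exists2 m : \bar R, m \is a fin_num &
      is_min (range (weighted_cost f l d gamma1 gamma2 x0)) m.

(* [v] is the minimum over [u] of [l x u + W (f x u)]; the minimum is attained,
   but neither [v] nor the values of [W] are assumed finite. *)
Definition bellman_min f l (W : 'rV[R]_nX -> \bar R) (x : 'rV[R]_nX)
    (v : \bar R) : Prop :=
  is_min (range (fun u => l x u + W (f x u))%E) v.

(* The extension to homogeneous rays used in the approximate scheme: [opt] is
   [Num.min] for the lower sequence and [Num.max] for the upper one. *)
Definition approx_value_iteration (opt : R -> R -> R) f l
    (r : 'rV[R]_nX) (nu mu : R) (D : set 'rV[R]_nX)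
    (W : nat -> 'rV[R]_nX -> \bar R) : Prop :=
  (forall i, W i 0 = 0%E) /\
  (forall i x, D x ->
    bellman_min f l (W i) x (W i.+1 x) /\
    (forall e : R, 0 < e ->
      W i.+1 (dilation r e x) =
        ((opt (e `^ mu) (e `^ (mu * nu ^+ i.+1)))%:E * W i.+1 x)%E)).

End System.
End Defs.

(* Main.v *)
(* Replaying an optimal input sequence for [x], with the [k]-th input dilated by
   [e ^ (nu ^ k)], from the dilated state multiplies the [k]-th stage cost by
   [e ^ (mu * nu ^ k)].  This exponent is monotone in [k], so the factors all lie
   between the two extreme ones, whence
   [V_i (dilation e x) <= max (e ^ mu) (e ^ (mu * nu ^ i)) * V_i x], and
   the matching lower bound follows by dilating back.  The approximate schemes
   extend from [D] along rays by exactly these extreme factors, so the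
   comparison on [D], which is monotonicity of the Bellman operator, extends to
   all nonzero states.  At the origin, a dilation with [e ^ mu < 1] forces the
   finite value [V_i 0] to vanish; for [mu = 0] this needs [origin_mu0]. *)
Require Import Defs.
From HB Require Import structures.
From mathcomp Require Import all_boot all_order all_algebra.
From mathcomp Require Import all_classical all_reals all_analysis.
Import Order.TTheory GRing.Theory Num.Theory.
Import numFieldNormedType.Exports.
Local Open Scope classical_set_scope.
Local Open Scope ring_scope.


Set Implicit Arguments.
Unset Strict Implicit.

Section Homogeneity.
Context {R : realType}.
Implicit Types (a e nu mu : R).

Lemma dilation0 n (r : 'rV[R]_n) e : dilation r e 0 = 0.
Proof. by apply/rowP => j; rewrite !mxE mulr0. Qed.

Lemma dilationK n (r : 'rV[R]_n) e (x : 'rV[R]_n) :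
  0 < e -> dilation r e^-1 (dilation r e x) = x.
Proof.
move=> e_gt0; apply/rowP => j.
by rewrite !mxE mulrA -powRM ?invr_ge0 ?ltW// mulVf ?gt_eqF// powR1 mul1r.
Qed.

Lemma powRV e mu : 0 < e -> e^-1 `^ mu = (e `^ mu)^-1.
Proof. by move=> e_gt0; rewrite -powR_inv1 ?ltW// -powRrM mulN1r powRN. Qed.

(** Since [nu] lies between [1] and [nu ^+ n.+1], and a power of [a] is monotone in its exponent, an
    endpoint dominates. *)
Lemma powR_le_max_exp a nu n :
  0 < a -> 0 < nu -> a `^ nu <= Num.max a (a `^ (nu ^+ n.+1)).
Proof.
move=> a_gt0 nu_gt0; rewrite le_max -{2}(powRr1 (ltW a_gt0)).
have [a_ge1|a_lt1] := leP 1 a; have [nu_ge1|nu_lt1] := leP 1 nu.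
- by apply/orP; right; rewrite ler_powR// ler_eXnr.
- by apply/orP; left; rewrite ler_powR// ltW.
- by apply/orP; left; rewrite ger_powR// a_gt0 ltW.
- by apply/orP; right; rewrite ger_powR ?a_gt0 ?(ltW a_lt1)// ler_iXnr// ltW.
Qed.

Definition max_factor mu nu i e := Num.max (e `^ mu) (e `^ (mu * nu ^+ i)).
Definition min_factor mu nu i e := Num.min (e `^ mu) (e `^ (mu * nu ^+ i)).

Lemma max_factor_ge0 mu nu i e : 0 <= max_factor mu nu i e.
Proof. by rewrite le_max powR_ge0. Qed.

Lemma min_factor_ge0 mu nu i e : 0 <= min_factor mu nu i e.
Proof. by rewrite le_min !powR_ge0. Qed.

(** Inversion exchanges the smaller and the larger power; this turns an upper bound at [e^-1] into a
    lower bound at [e]. *)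
Lemma min_max_factorV mu nu i e :
  0 < e -> min_factor mu nu i e * max_factor mu nu i e^-1 = 1.
Proof.
move=> e_gt0; rewrite /min_factor /max_factor !powRV//.
have := powR_gt0 mu e_gt0; have := powR_gt0 (mu * nu ^+ i) e_gt0.
move: (e `^ mu) (e `^ _) => a b b_gt0 a_gt0.
have [ab|/ltW ba] := leP a b.
  by rewrite max_l ?lef_pV2// mulfV ?gt_eqF.
by rewrite max_r ?lef_pV2// mulfV ?gt_eqF.
Qed.

(** Serves the induction on [i]: one step of [f] turns a dilation by [e] into one by [e]^ nu[. Of
    the two powers on the left, one is the second power on the right, the other falls
    under]powR_le_max_exp[with]a = e [^ mu]. *)
Lemma max_factorS mu nu i e : 0 < e -> 0 < nu ->
  max_factor mu nu i (e `^ nu) <= max_factor mu nu i.+1 e.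
Proof.
move=> e_gt0 nu_gt0; rewrite /max_factor ge_max -!powRrM; apply/andP; split.
  by rewrite (mulrC nu) !(powRrM _ mu) powR_le_max_exp ?powR_gt0.
by rewrite mulrCA -exprS le_max lexx orbT.
Qed.

End Homogeneity.

Section ValueIteration.
Context {R : realType} {nX nU : nat}.
Variables (f : 'rV[R]_nX -> 'rV[R]_nU -> 'rV[R]_nX)
  (l : 'rV[R]_nX -> 'rV[R]_nU -> \bar R).

Lemma bellman_min_le (W W' : 'rV[R]_nX -> \bar R) x v v' :
  (forall y, W y <= W' y)%E ->
  bellman_min f l W x v -> bellman_min f l W' x v' -> (v <= v')%E.
Proof.
move=> WW' [_ v_lb] [[u _ <-] _].
by apply: (@le_trans _ _ (l x u + W (f x u))%E); [apply: v_lb; exists u | exact: leeD2l].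
Qed.

Hypothesis l_ge0 : forall x u, (0 <= l x u)%E.
Variable V : nat -> 'rV[R]_nX -> \bar R.
Hypothesis V_step : forall i x, bellman_min f l (V i) x (V i.+1 x).
Hypothesis V_init_ge0 : forall x, (0 <= V 0 x)%E.

Lemma V_ge0 i x : (0 <= V i x)%E.
Proof.
elim: i x => [//|i IH] x; have [[u _ <-] _] := V_step i x.
exact: adde_ge0.
Qed.

Lemma stage_cost_finite : optimal_cost_attained f l ->
  forall x, exists u, (l x u < +oo)%E.
Proof.
(* With horizon one and [gamma1 = 1] the weighted cost is a single stage cost of weight 1. *)
move=> /(_ (Some 1) 1 0) + x => /(_ x isT ltr01) [m m_fin [[u _ um] _]].
exists (u 0); rewrite ltey_eq.
by move: um m_fin; rewrite /weighted_cost big_nat1 powR1 mul1e => -> ->.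
Qed.

Lemma V_fin_num i x : optimal_cost_attained f l ->
  (forall y, V 0 y < +oo)%E -> V i x \is a fin_num.
Proof.
move=> opt V_init_fin; rewrite ge0_fin_numE ?V_ge0//.
elim: i x => [//|i IH] x; have [u lu] := stage_cost_finite opt x.
have [_ V_lb] := V_step i x.
by apply: le_lt_trans (lte_add_pinfty lu (IH (f x u))); apply: V_lb; exists u.
Qed.

Variables (nu mu : R) (r : 'rV[R]_nX) (q : 'rV[R]_nU).
Hypothesis nu_gt0 : 0 < nu.
Hypothesis f_hom : forall x u (e : R), 0 < e ->
  f (dilation r e x) (dilation q e u) = dilation r (e `^ nu) (f x u).
Hypothesis l_hom : forall x u (e : R), 0 < e ->
  l (dilation r e x) (dilation q e u) = ((e `^ mu)%:E * l x u)%E.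
Hypothesis V_init_hom : forall x (e : R), 0 < e ->
  V 0 (dilation r e x) = ((e `^ mu)%:E * V 0 x)%E.

Lemma V_dilation_le i x (e : R) : 0 < e ->
  (V i (dilation r e x) <= (max_factor mu nu i e)%:E * V i x)%E.
Proof.
elim: i x e => [|i IH] x e e_gt0.
  by rewrite /max_factor expr0 mulr1 maxxx V_init_hom.
have [[u _ <-] _] := V_step i x; have [_ V_lb] := V_step i (dilation r e x).
(* The dilated minimizer for [x] is a competitor at the dilated state. *)
apply: (@le_trans _ _ (l (dilation r e x) (dilation q e u) +
    V i (f (dilation r e x) (dilation q e u)))%E).
  by apply: V_lb; exists (dilation q e u).
rewrite f_hom// l_hom// ge0_muleDr ?V_ge0//; apply: leeD.
  by rewrite lee_wpmul2r// lee_fin le_max lexx.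
apply: le_trans (IH _ _ (powR_gt0 _ e_gt0)) _.
by rewrite lee_wpmul2r ?V_ge0// lee_fin max_factorS.
Qed.

Lemma V_dilation_ge i x (e : R) : 0 < e ->
  ((min_factor mu nu i e)%:E * V i x <= V i (dilation r e x))%E.
Proof.
move=> e_gt0; have eV_gt0 : 0 < e^-1 by rewrite invr_gt0.
(* View [x] as the dilation by [e^-1] of [dilation r e x], so that the upper bound applies to it. *)
rewrite -{1}(dilationK r x e_gt0) -[leRHS]mul1e -(min_max_factorV mu nu i e_gt0).
rewrite EFinM -muleA lee_wpmul2l ?lee_fin ?min_factor_ge0//.
exact: V_dilation_le.
Qed.

Lemma V_origin i : optimal_cost_attained f l ->
  (mu = 0 -> exists u, f 0 u = 0 /\ l 0 u = 0%E) ->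
  V 0 0 = 0%E -> (forall y, V 0 y < +oo)%E -> V i 0 = 0%E.
Proof.
move=> opt origin_mu0 V00 V_init_fin.
have [mu0|mu_neq0] := eqVneq mu 0.
  (* Here every factor is 1 and dilating says nothing; instead [u] keeps the state at the origin for
     free. *)
  have [u [fu lu]] := origin_mu0 mu0; elim: i => [//|i IH].
  apply/eqP; rewrite eq_le V_ge0 andbT; have [_ V_lb] := V_step i 0.
  by apply: V_lb; exists u => //; rewrite fu lu IH adde0.
pose e : R := 2^-1 `^ mu^-1.
have e_gt0 : 0 < e by rewrite powR_gt0// invr_gt0.
have e_mu : e `^ mu = 2^-1 by rewrite -powRrM mulVf// powRr1// invr_ge0.
have factor_lt1 : max_factor mu nu i e < 1.
  rewrite /max_factor powRrM e_mu gt_max invf_lt1// ltr1n/=.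
  have := @gt0_ltr_powR R _ (exprn_gt0 i nu_gt0) 2^-1 1.
  by rewrite powR1 !nnegrE invr_ge0 invf_lt1// ltr1n; apply.
(* Dilations fix the origin, so its value is at most a factor below 1 times itself; finiteness
   excludes [+oo]. *)
have := V_dilation_le i 0 e_gt0; rewrite dilation0.
have := V_ge0 i 0; rewrite -(fineK (V_fin_num i 0 opt V_init_fin)).
move: (fine _) => v; rewrite -EFinM !lee_fin => v_ge0 v_le.
congr EFin; apply/eqP; rewrite eq_le v_ge0 andbT leNgt; apply/negP => v_gt0.
by move: v_le; rewrite leNgt gtr_pMl ?factor_lt1.
Qed.

End ValueIteration.

Unset Implicit Arguments.

Theorem proposition1 (R : realType) (nX nU : nat)
  (nX_gt0 : (0 < nX)%N) (nU_gt0 : (0 < nU)%N)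
  (f : 'rV[R]_nX -> 'rV[R]_nU -> 'rV[R]_nX)
  (l : 'rV[R]_nX -> 'rV[R]_nU -> \bar R)
  (l_ge0 : forall x u, (0 <= l x u)%E)
  (nu mu : R) (r : 'rV[R]_nX) (q : 'rV[R]_nU)
  (nu_gt0 : 0 < nu)
  (r_gt0 : forall j, 0 < r 0 j) (q_gt0 : forall j, 0 < q 0 j)
  (f_hom : forall x u (e : R), 0 < e ->
    f (dilation r e x) (dilation q e u) = dilation r (e `^ nu) (f x u))
  (l_hom : forall x u (e : R), 0 < e ->
    l (dilation r e x) (dilation q e u) = ((e `^ mu)%:E * l x u)%E)
  (opt_attained : optimal_cost_attained f l)
  (origin_mu0 : mu = 0 -> exists u, f 0 u = 0 /\ l 0 u = 0%E)
  (V0 : 'rV[R]_nX -> R)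
  (V0_ge0 : forall x, 0 <= V0 x)
  (V0_hom : forall x (e : R), 0 < e -> V0 (dilation r e x) = e `^ mu * V0 x)
  (V : nat -> 'rV[R]_nX -> \bar R)
  (V_init : forall x, V 0%N x = (V0 x)%:E)
  (V_step : forall i x, bellman_min f l (V i) x (V i.+1 x))
  (D : set 'rV[R]_nX)
  (D_compact : compact D)
  (D_rays : \bigcup_(x in D) homogeneous_ray r x = [set~ 0])
  (Vlo Vup : nat -> 'rV[R]_nX -> \bar R)
  (Vlo_init : forall x, Vlo 0%N x = (V0 x)%:E)
  (Vup_init : forall x, Vup 0%N x = (V0 x)%:E)
  (Vlo_scheme : approx_value_iteration Num.min f l r nu mu D Vlo)
  (Vup_scheme : approx_value_iteration Num.max f l r nu mu D Vup) :
  (forall i x, (Vlo i x <= V i x)%E /\ (V i x <= Vup i x)%E) /\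
  (mu = 0 \/ nu = 1 -> forall i x, Vlo i x = V i x /\ V i x = Vup i x).
Proof.
have V00 : V 0%N 0 = 0%E by rewrite V_init -Vlo_init; case: Vlo_scheme.
have V_init_ge0 x : (0 <= V 0%N x)%E by rewrite V_init lee_fin.
have V_init_hom x e : 0 < e ->
    V 0%N (dilation r e x) = ((e `^ mu)%:E * V 0%N x)%E.
  by move=> e_gt0; rewrite !V_init V0_hom// EFinM.
have V_at0 i : V i 0 = 0%E.
  by apply:
    (V_origin l_ge0 V_step V_init_ge0 nu_gt0 f_hom l_hom V_init_hom) => // y; rewrite V_init ltry.
have ray x : x != 0 -> exists2 y, D y & exists2 e, 0 < e & dilation r e y = x.
  move=> /eqP x_neq0; have : [set~ 0] x by [].
  by rewrite -D_rays => -[y Dy [e e_gt0 <-]]; exists y => //; exists e.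
case: Vlo_scheme Vup_scheme => [Vlo_at0 Vlo_rec] [Vup_at0 Vup_rec].
have bounds i x : (Vlo i x <= V i x)%E /\ (V i x <= Vup i x)%E.
  elim: i x => [|i IH] x; first by rewrite Vlo_init Vup_init V_init.
  (* The rays through [D] miss only the origin, which is treated apart. *)
  have [->|/ray[y Dy [e e_gt0 <-]]] := eqVneq x 0.
    by rewrite Vlo_at0 Vup_at0 V_at0.
  have [lo_min ->//] := Vlo_rec i y Dy; have [up_min ->//] := Vup_rec i y Dy.
  split.
    apply: le_trans
      (V_dilation_ge l_ge0 V_step V_init_ge0 nu_gt0 f_hom l_hom V_init_hom _ _ e_gt0).
    rewrite lee_wpmul2l ?lee_fin ?min_factor_ge0//.
    by apply: bellman_min_le lo_min (V_step i y) => z; case: (IH z).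
  apply: le_trans
    (V_dilation_le l_ge0 V_step V_init_ge0 nu_gt0 f_hom l_hom V_init_hom _ _ e_gt0) _.
  rewrite lee_wpmul2l ?lee_fin ?max_factor_ge0//.
  by apply: bellman_min_le (V_step i y) up_min => z; case: (IH z).
split=> // degenerate.
(* In both degenerate cases the two exponents agree, so [Num.min] and [Num.max] give the same
   extension and both schemes obey one recursion. The sandwich then forces equality with [V]. *)
have lo_up i x : Vlo i x = Vup i x.
  elim: i x => [|i IH] x; first by rewrite Vlo_init Vup_init.
  have [->|/ray[y Dy [e e_gt0 <-]]] := eqVneq x 0.
    by rewrite Vlo_at0 Vup_at0.
  have [lo_min ->//] := Vlo_rec i y Dy; have [up_min ->//] := Vup_rec i y Dy.
  have -> : mu * nu ^+ i.+1 = mu.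
    by case: degenerate => ->; rewrite ?mul0r// expr1n mulr1.
  rewrite minxx maxxx; congr (_ * _)%E; apply/eqP; rewrite eq_le.
  by apply/andP; split; [apply: bellman_min_le lo_min up_min |
    apply: bellman_min_le up_min lo_min] => z; rewrite IH.
move=> i x; have [lo_le le_up] := bounds i x.
by split; apply/eqP; rewrite eq_le ?lo_le ?le_up ?andbT//= ?lo_up// -lo_up.
Qed.
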